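(* Let $p,q$ be primes with $q\mid p-1$, let $\Gamma$ be a connected normal edge-transitive Cayley graph for $G_{pq}$, and let $T$ be the Sylow $p$-subgroup of $G_{pq}$. Then $\Gamma$ is a normal multicover of $\Gamma_T$, where $\Gamma_T\cong K_2$ if $q=2$ and $\Gamma_T\cong C_q$ if $q$ is odd, and $\Gamma$ is isomorphic to one of the following graphs: (i) $C_q[\overline{K_p}]$ if $q$ is odd, or $K_2[\overline{K_p}]$ if $q=2$; (ii) $K_p\times C_q$ if $q$ is odd, or $K_p\times K_2$ if $q=2$; (iii) $\Gamma(pq,\ell,i)$ for some proper divisor $\ell$ of $p-1$ with $\ell>1$, and some $i$ with either $(q,i)=(2,1)$ or $1\le i\le(q-1)/2$.
   Context: For a group $G$ and an inverse-closed subset $S\subseteq G\setminus\{1\}$, $\mathrm{Cay}(G,S)$ is the graph with vertex set $G$ and edges $\{x,y\}$ with $yx^{-1}\in S$. Let $\rho(g):x\mapsto xg$. $\Gamma=\mathrm{Cay}(G,S)$ is normal edge-transitive (for $G$) if $N_{\mathrm{Aut}\,\Gamma}(\rho(G))$ is transitive on the (undirected) edges of $\Gamma$. For $H\leqslant\mathrm{Aut}(G)$ and $g\in G\setminus\{1\}$, $\Gamma(G,H,g):=\mathrm{Cay}(G,g^H\cup g^{-H})$, where $g^H$ is the $H$-orbit of $g$ and $g^{-H}=(g^{-1})^H$. Let $A=\mathrm{AGL}(1,p)$ be the group of maps $x\mapsto xa+b$ of $\mathbb{Z}_p$ ($a\ne0$), with maps composed left to right. Let $m$ be a fixed primitive element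 of $\mathbb{Z}_p$, write $m$ also for the map $x\mapsto xm$, and let $t:x\mapsto x+1$, so $m^{-1}tm=t^m$. Put $z=m^{(p-1)/q}$; $G_{pq}=\langle z,t\rangle$ is, up to isomorphism, the nonabelian group of order $pq$, and $T=\langle t\rangle$. Subgroups of $A$ act as automorphisms of $G_{pq}$ by conjugation. For a divisor $\ell>1$ of $p-1$ let $H_{(\ell,1)}=\langle m^{(p-1)/\ell}t\rangle$, and for $1\le i\le q-1$ define $\Gamma(pq,\ell,i):=\Gamma(G_{pq},H_{(\ell,1)},z^i)$. For a normal subgroup $M$ of $G$ invariant under the given automorphism group, the normal quotient $\Gamma_M$ has as vertices the cosets of $M$, two distinct cosets being adjacent iff some vertex of one is adjacent in $\Gamma$ to some vertex of the other. $\Gamma$ is a normal multicover of $\Gamma_M$ if for all pairs of adjacent cosets $B,B'$ each vertex of $B$ is adjacent to the same positive number of vertices of $B'$. $C_q$ is the cycle of length $q$, $\overline{K_p}$ the empty graph on $p$ vertices. The direct product $\Sigma\times\Delta$ has vertex set $V\Sigma\times V\Delta$ with $(\alpha_1,\beta_1)\sim(\alpha_2,\beta_2)$ iff $\alpha_1\sim\alpha_2$ and $\beta_1\sim\beta_2$. The lexicographic product $\Sigma[\Delta]$ has the same vertex set, with $(\alpha_1,\beta_1)\sim(\alpha_2,\beta_2)$ iff $\alpha_1\sim\alpha_2$, or $\alpha_1=\alpha_2$ and $\beta_1\sim\beta_2$. *)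

(* Defs.v *)
From HB Require Import structures.
From mathcomp Require Import all_boot all_order all_algebra all_fingroup all_solvable.

Set Implicit Arguments.
Unset Strict Implicit.
Unset Printing Implicit Defensive.

Import GroupScope.

(* A graph is an adjacency relation [e : rel V] on a finite vertex type [V].  *)

Definition graph_iso (V W : finType) (e : rel V) (f : rel W) : Prop :=
  exists2 phi : V -> W, bijective phi & forall x y, f (phi x) (phi y) = e x y.

Definition graph_connected (V : finType) (e : rel V) : Prop :=
  forall x y : V, connect e x y.

Definition edges (V : finType) (e : rel V) : {set {set V}} :=
  [set [set u.1; u.2] | u : V * V & e u.1 u.2].

Definition graph_aut (V : finType) (e : rel V) : {set {perm V}} :=
  [set s : {perm V} | [forall x, forall y, e (s x) (s y) == e x y]].

Lemma graph_aut_group_set (V : finType) (e : rel V) : group_set (graph_aut e).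
Proof.
apply/group_setP; split=> [|s u].
  by rewrite inE; apply/forallP=> x; apply/forallP=> y; rewrite !perm1.
rewrite !inE => /forallP hs /forallP hu.
apply/forallP=> x; apply/forallP=> y; rewrite !permM.
by rewrite (eqP (forallP (hu _) _)) (eqP (forallP (hs _) _)).
Qed.

Canonical graph_aut_group (V : finType) (e : rel V) : {group {perm V}} :=
  Group (graph_aut_group_set e).

Definition complete_graph (n : nat) : rel 'I_n := fun i j => i != j.

Definition empty_graph (n : nat) : rel 'I_n := fun _ _ => false.

(* A cycle only for [2 < n]. *)
Definition cycle_graph (n : nat) : rel 'I_n :=
  fun i j => (i.+1 == j %[mod n]) || (j.+1 == i %[mod n]).

Arguments complete_graph n i j : clear implicits.
Arguments empty_graph n _ _ : clear implicits.
Arguments cycle_graph n i j : clear implicits.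

Definition direct_prod (V W : finType) (e : rel V) (f : rel W) : rel (V * W) :=
  fun x y => e x.1 y.1 && f x.2 y.2.

Definition lex_prod (V W : finType) (e : rel V) (f : rel W) : rel (V * W) :=
  fun x y => e x.1 y.1 || (x.1 == y.1) && f x.2 y.2.

(* Cayley graphs of the full group of elements of [gT]. *)

Definition Cay (gT : finGroupType) (S : {set gT}) : rel gT :=
  fun x y => y * x^-1 \in S.

Definition rho (gT : finGroupType) (g : gT) : {perm gT} := perm (mulIg g).

Definition normaliser_rho (gT : finGroupType) (e : rel gT) : {set {perm gT}} :=
  'N_(graph_aut e)(@rho gT @: [set: gT]).

Definition normal_edge_transitive (gT : finGroupType) (e : rel gT) : Prop :=
  [transitive normaliser_rho e, on edges e | ('P)^*].

(* Meant for [H] a subgroup of [Aut [set: gT]] and [g != 1]. *)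
Definition Gamma (gT : finGroupType) (H : {set {perm gT}}) (g : gT) : rel gT :=
  Cay (orbit 'P H g :|: orbit 'P H g^-1).

(* For [M] normal, [coset_of M] is the type of all cosets of [M]. *)
Definition normal_quotient (gT : finGroupType) (e : rel gT) (M : {group gT}) :
    rel (coset_of M) :=
  fun B B' =>
    (B != B') &&
    [exists x, exists y, [&& x \in val B, y \in val B' & e x y]].

Arguments normal_quotient {gT} e M B B'.

(* The second clause is the invariance of [M] under the automorphism group of *)
(* the Cayley graph: conjugation by an [s] in the normaliser that fixes 1     *)
(* sends [rho g] to [rho (s g)].                                              *)
Definition normal_multicover (gT : finGroupType) (e : rel gT) (M : {group gT}) :
    Prop :=
  [/\ M <| [set: gT],
      normaliser_rho e \subset 'N(@rho gT @: M)
    & forall B B' : coset_of M, normal_quotient e M B B' ->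
        exists2 k : nat, (0 < k)%N &
          forall x, x \in val B -> #|[set y in val B' | e x y]| = k].

(* The maps x |-> x a and x |-> x + 1 of Z_p; products of permutations are    *)
(* composed left to right.                                                    *)

Definition scale_perm (p : nat) (a : {unit 'F_p}) : {perm 'F_p} :=
  perm (GRing.mulIr (valP a)).

Definition trans1 (p : nat) : {perm 'F_p} := perm (GRing.addIr (1%R : 'F_p)).

Definition zelt (p q : nat) (m : {unit 'F_p}) : {perm 'F_p} :=
  scale_perm m ^+ (p.-1 %/ q).

Definition Gpq (p q : nat) (m : {unit 'F_p}) : {group {perm 'F_p}} :=
  <<[set zelt q m; trans1 p]>>%G.

Arguments Gpq p q m : clear implicits.

Definition H1 (p : nat) (m : {unit 'F_p}) (l : nat) : {group {perm 'F_p}} :=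
  <[scale_perm m ^+ (p.-1 %/ l) * trans1 p]>%G.

(* The automorphisms of [G] induced by conjugation by elements of [H].        *)
Definition conj_auts (gT : finGroupType) (G : {group gT}) (H : {set gT}) :
    {set {perm subg_of G}} :=
  [set a : {perm subg_of G} |
    [exists h in H, [forall x, sgval (a x) == sgval x ^ h]]].

Definition Gamma_pq (p q : nat) (m : {unit 'F_p}) (l i : nat) :
    rel (subg_of (Gpq p q m)) :=
  Gamma (conj_auts (Gpq p q m) (H1 m l)) (subg (Gpq p q m) (zelt q m ^+ i)).

Arguments Gamma_pq p q m l i : clear implicits.

(* Main.v *)
Require Import Defs.
From mathcomp Require Import all_boot all_order all_algebra all_fingroup all_solvable.
From mathcomp Require Import ring.

(* In the coordinates [s |-> s * slope + shift], every automorphism of G_pq   *)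
(* preserves slopes and acts on the shifts of the elements of a given slope   *)
(* by an affine map of F_p.  Edge-transitivity therefore says that S consists *)
(* of the elements of one slope a with shift in a set B, and their inverses,  *)
(* where the affine maps preserving B are transitive on B; connectedness      *)
(* gives a <> 1 and |B| > 1.  Then B is either F_p or, centred at its         *)
(* centroid, a coset of the group of l-th roots of unity with l > 1, and the  *)
(* isomorphism type depends on B only up to affine maps, because conjugation  *)
(* by AGL(1,p) realizes all of them.  The three cases are B = F_p, l = p - 1  *)
(* and 1 < l < p - 1.                                                         *)

Set Implicit Arguments.
Unset Strict Implicit.
Unset Printing Implicit Defensive.

Import GroupScope GRing.Theory.

(** Normal edge-transitivity enters through group automorphisms: a normalising permutation divided
    by its value at 1 is an automorphism preserving [S], and such automorphisms carry any element of
    [S] to any other up to inversion ([Cay_aut_transitive]). They preserve slopes and are affine on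
    shifts ([aut_affine]), so [S] is encoded by one slope [a] and one subset [shift_set] of [F_p]
    ([Cay_shift_set], [shift_set_homogeneous]). Field arithmetic classifies that subset
    ([affine_homogeneous_set]), and [slope_graph_affine_iso] removes the choice of affine
    coordinate.

    [Cay_trichotomy] reads off the graphs: logarithms to base [a] lay the slopes along the cycle,
    and [roots_Gamma_pq_iso] matches roots of unity with the orbit of [H1]. The quotient by [T]
    forgets the shift and leaves the cycle; uniform valency between cosets comes from right
    translations ([Cay_multicover]). *)

(** * Isomorphic and connected graphs *)

Lemma graph_iso_trans (U V W : finType) (d : rel U) (e : rel V) (f : rel W) :
  graph_iso d e -> graph_iso e f -> graph_iso d f.
Proof.
move=> [phi phi_bij phiE] [psi psi_bij psiE]; exists (psi \o phi).
  exact: bij_comp.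
by move=> x y; rewrite /= psiE phiE.
Qed.

Lemma graph_iso_eqr (V W : finType) (e : rel V) (f g : rel W) :
  f =2 g -> graph_iso e f -> graph_iso e g.
Proof. by move=> fg [phi phi_bij phiE]; exists phi => // x y; rewrite -fg. Qed.

Lemma graph_connected_closed (V : finType) (e : rel V) (P : pred V) (x y : V) :
  graph_connected e -> (forall u v, e u v -> P u = P v) -> P x = P y.
Proof.
move=> conn eP; have := conn x y.
by apply: (@closed_connect _ e P) => u v /eP.
Qed.

(** * Cayley graphs and the normaliser of the right translations *)

Section Cayley.

Variables (gT : finGroupType) (S : {set gT}).

Lemma rhoE (g x : gT) : rho g x = x * g.
Proof. by rewrite permE. Qed.

Lemma rho_inj : injective (@rho gT).
Proof. by move=> g h /permP/(_ 1); rewrite !rhoE !mul1g. Qed.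

Lemma rhoX (g : gT) n : rho g ^+ n = rho (g ^+ n).
Proof.
elim: n => [|n IHn]; first by apply/permP=> x; rewrite rhoE mulg1 perm1.
by apply/permP=> x; rewrite !expgSr IHn permM !rhoE mulgA.
Qed.

(** Conjugation by [n] turns [rho g] into some [rho h], and evaluating at 1 identifies [h]. Hence
    [x |-> n x * (n 1)^-1] is a group automorphism. *)
Lemma normaliser_rhoM (e : rel gT) (n : {perm gT}) :
  n \in normaliser_rho e -> forall g x, n (x * g) = n x * ((n 1)^-1 * n g).
Proof.
rewrite !inE => /andP[_ nN] g x.
have /imsetP[h _ Eh]: rho g ^ n \in rho (gT:=gT) @: [set: gT].
  by apply: (subsetP nN); rewrite memJ_conjg imset_f ?inE.
have E y : n (y * g) = n y * h.
  by rewrite -rhoE -permM -[in RHS]rhoE -Eh -permM mulgA mulgV mul1g.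
by rewrite E -[g]mul1g E mulKg.
Qed.

(** An element [n] of the normaliser takes the edge [{1, s}] to [{1, s'}], and [f] is [n] followed
    by right division by [n 1]. The two alternatives come from [n 1 = 1] and [n 1 = s']. *)
Lemma Cay_aut_transitive (s s' : gT) :
    normal_edge_transitive (Cay S) -> s \in S -> s' \in S ->
  exists f : gT -> gT,
    [/\ {morph f : x y / x * y}, injective f, forall x, (f x \in S) = (x \in S)
      & f s = s' \/ f s = s'^-1].
Proof.
move=> net sS s'S.
have edge1 x : x \in S -> [set 1; x] \in edges (Cay S).
  move=> xS; apply/imsetP; exists (1, x) => //.
  by rewrite inE /Cay /= invg1 mulg1.
have [n nN En] := atransP2 net (edge1 s sS) (edge1 s' s'S).
have {}En : [set 1; s'] = [set n 1; n s].
  by rewrite En /= /setact imsetU1 imset_set1 /=.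
have nM := normaliser_rhoM nN.
exists (fun x => n x * (n 1)^-1); split.
- by move=> x y /=; rewrite nM !mulgA.
- by move=> x y /mulIg/perm_inj.
- move=> x; move: nN; rewrite !inE => /andP[/forallP/(_ 1)/forallP/(_ x)/eqP E _].
  by move: E; rewrite /Cay => ->; rewrite invg1 mulg1.
have: n 1 \in [set 1; s'] by rewrite En !inE eqxx.
have: n s \in [set 1; s'] by rewrite En !inE eqxx orbT.
have n1s : n 1 = n s -> 1 = s by exact: perm_inj.
have: s' \in [set n 1; n s] by rewrite -En !inE eqxx orbT.
have: 1 \in [set n 1; n s] by rewrite -En !inE eqxx.
rewrite !inE => H1 H2 /orP[]/eqP Es /orP[]/eqP E1;
  rewrite ?Es ?E1 ?invg1 ?mulg1 ?mul1g ?mulgV; auto.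
- left; move: H2; rewrite Es E1 orbb eq_sym; move/eqP=> <-; exact/eqP.
- by left; move: H1; rewrite Es E1 orbb => /eqP <-.
Qed.

(** The exponent condition makes [M] characteristic, which gives the invariance. Valencies agree
    because the right translation moving [x0] to [x] within its coset is a graph automorphism and,
    [M] being normal, maps every coset to itself. *)
Lemma Cay_multicover (M : {group gT}) :
    M <| [set: gT] ->
    (forall x, x ^+ #|M| = 1 -> x \in M) ->
  normal_multicover (Cay S) M.
Proof.
move=> nsM expM; split=> //.
  apply/subsetP=> n; rewrite !inE => /andP[_ nN].
  apply/subsetP=> _ /imsetP[_ /imsetP[g gM ->] ->].
  have /imsetP[h _ Eh]: rho g ^ n \in rho (gT:=gT) @: [set: gT].
    by apply: (subsetP nN); rewrite memJ_conjg imset_f ?inE.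
  rewrite Eh imset_f // expM //; apply: rho_inj.
  have rho1 : rho (1 : gT) = 1 by apply/permP=> x; rewrite rhoE mulg1 perm1.
  by rewrite -rhoX -Eh -conjXg rhoX (expg_cardG gM) rho1 conj1g.
move=> B B' /andP[_ /existsP[x0 /existsP[y0 /and3P[x0B y0B' e0]]]].
have nM x : x \in 'N(M) by apply: (subsetP (normal_norm nsM)); rewrite inE.
have BE (C : coset_of M) x y : x \in val C -> (y \in val C) = (y * x^-1 \in M).
  have [z _ ->] := cosetP C; rewrite /= val_coset // !mem_rcoset => xC.
  by rewrite -[RHS](groupMr _ xC) mulgA mulgKV.
exists #|[set y in val B' | Cay S x0 y]|.
  by apply/card_gt0P; exists y0; rewrite inE y0B'.
move=> x xB; have xx0: x0 * x^-1 \in M by rewrite -(BE B).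
rewrite -[RHS](card_imset _ (@mulIg _ (x0^-1 * x))) /=.
apply: eq_card => y; apply/idP/imsetP.
  rewrite inE /Cay => /andP[yB' exy]; exists (y * (x^-1 * x0)).
    rewrite inE (BE _ _ _ yB') -[_ * y^-1](mulgA y) -{1}(invgK y) -conjgE.
    rewrite /Cay -!mulgA mulgV mulg1 exy andbT.
    rewrite memJ_norm // -(memJ_norm _ (nM x^-1)) conjgE invgK.
    by rewrite !mulgA mulgV mul1g.
  by rewrite -!mulgA mulKVg mulVg mulg1.
case=> w; rewrite [w \in _]inE /Cay => /andP[wB' ew] ->.
rewrite inE (BE _ _ _ wB') -[_ * w^-1](mulgA w) -{1}(invgK w) -conjgE /Cay.
rewrite !mulgA mulgK ew andbT.
rewrite memJ_norm // -(memJ_norm _ (nM x0^-1)) conjgE invgK !mulgA mulgV mul1g.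
by rewrite -groupV invMg invgK.
Qed.

End Cayley.

(** * Affinely homogeneous subsets of [F_p] *)

Lemma Fp_natr_neq0 (p n : nat) : prime p -> (0 < n < p)%N -> (n%:R != 0 :> 'F_p)%R.
Proof.
move=> p_pr /andP[n_gt0 n_lt].
by rewrite -(dvdn_pcharf (pchar_Fp p_pr)) gtnNdvd.
Qed.

(* The centroid of a proper subset of [F_p] is fixed by every affine map *)
(* preserving the subset, which reduces to a multiplicative group acting *)
(* regularly.                                                            *)
Lemma affine_homogeneous_set (p : nat) (B : {set 'F_p}) : prime p ->
    (forall b b', b \in B -> b' \in B -> exists k c : 'F_p,
       [/\ k != 0, k * b + c = b' & forall x, (k * x + c \in B) = (x \in B)]%R) ->
    (1 < #|B|)%N ->
  B = [set: 'F_p] \/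
  exists (c d : 'F_p) (l : nat), [/\ c != 0%R, (1 < l)%N, l %| p.-1
    & forall x, (c * x + d \in B)%R = (x ^+ l == 1)%R].
Proof.
move=> p_pr homB B_gt1; have [Bp|B_ltp] := eqVneq #|B| p.
  by left; apply/eqP; rewrite eqEcard subsetT cardsT card_Fp // Bp leqnn.
right; set n := #|B| in B_gt1 B_ltp *.
have n0 : (n%:R != 0 :> 'F_p)%R.
  apply: Fp_natr_neq0 => //; rewrite (ltn_trans _ B_gt1) //= ltn_neqAle B_ltp.
  by rewrite -[X in _ <= X](card_Fp p_pr) max_card.
pose d : 'F_p := ((\sum_(b in B) b) / n%:R)%R.
have nd : (n%:R * d = \sum_(b in B) b)%R by rewrite mulrC divfK.
move: d nd => d nd.
(* Since [x |-> k * x + c] permutes [B], summing over [B] gives [n * d = k * (n * d) + n * c], and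
   [n] is invertible because [0 < n < p]. *)
have fix_d (k c : 'F_p) : (k != 0 -> (forall x, (k * x + c \in B) = (x \in B)) ->
    c = d - k * d)%R.
  move=> k0 kB; apply: (mulfI n0).
  have sumB : (\sum_(b in B) b = k * (\sum_(b in B) b) + n%:R * c)%R.
    have f_inj : injective (fun x : 'F_p => k * x + c)%R.
      by move=> x y /addIr/(mulfI k0).
    rewrite {1}(reindex_inj f_inj) /= (eq_bigl _ _ kB) big_split /=.
    by rewrite -mulr_sumr sumr_const mulr_natl.
  rewrite mulrBr mulrCA nd; apply/eqP; rewrite eq_sym subr_eq addrC.
  by rewrite {1}sumB.
have [b0 b0B] : exists b0, b0 \in B by apply/card_gt0P; apply: ltn_trans B_gt1.
pose c : 'F_p := (b0 - d)%R.
have c0 : c != 0%R.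
  rewrite subr_eq0; apply: contraTneq B_gt1 => Eb0.
  rewrite -leqNgt -(cards1 b0) subset_leq_card //; apply/subsetP=> b bB.
  have [k [e [k0 <- kB]]] := homB _ _ b0B bB.
  by rewrite (fix_d k e) // inE -Eb0 addrC subrK.
(* The multipliers about the centroid that preserve [B]; [u |-> c * u + d] will be a bijection from
   [K] onto [B], so [#|K| = n]. *)
pose K := [set u : {unit 'F_p} |
  [forall x, (val u * (x - d) + d \in B)%R == (x \in B)]].
have KP u : reflect (forall x, (val u * (x - d) + d \in B)%R = (x \in B)) (u \in K).
  by rewrite inE; apply: (iffP forallP) => uB x; apply/eqP.
have gK : group_set K.
  apply/group_setP; split=> [|u v /KP uK /KP vK]; apply/KP=> x.
    by rewrite mul1r subrK.
  by rewrite -(uK x) -[RHS]vK addrK /= mulrCA mulrA.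
pose KG := Group gK.
have memK x : (c * x + d \in B)%R -> exists2 u, u \in K & val u = x.
  move=> xB; have [k [e [k0 Ek kB]]] := homB _ _ b0B xB.
  have Ee := fix_d k e k0 kB.
  exists (FinRing.unit 'F_p (etrans (unitfE k) k0)).
    apply/KP=> y /=; rewrite -[RHS]kB Ee; congr (_ \in B); ring.
  rewrite /=; apply: (mulfI c0); rewrite /c.
  apply: (@addIr _ d); rewrite -Ek Ee; ring.
have Kmem u : u \in K -> (c * val u + d \in B)%R.
  by move=> /KP uK; rewrite mulrC uK.
have cardK : #|K| = n.
  have f_inj : injective (fun u : {unit 'F_p} => c * val u + d)%R.
    by move=> u v /addIr/(mulfI c0)/val_inj.
  rewrite -(card_imset _ f_inj); apply: eq_card => b; apply/imsetP/idP.
    by case=> u uK ->; apply: Kmem.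
  move=> bB; have E : (c * ((b - d) / c) + d = b)%R.
    by rewrite mulrCA divff // mulr1 subrK.
  have [|u uK Eu] := memK ((b - d) / c)%R; first by rewrite E.
  by exists u => //; rewrite Eu E.
have expK u : u \in K -> (val u ^+ n = 1)%R.
  by move=> uK; rewrite -cardK -FinRing.val_unitX (@expg_cardG _ KG).
exists c, d, n; split=> //.
  have := cardSg (subsetT KG).
  by rewrite cardK card_finField_unit card_Fp.
move=> x; apply/idP/eqP => [/memK[u uK <-]|xn]; first exact: expK.
have ux : (x \is a GRing.unit)%R.
  rewrite unitfE; apply: contra_eqN xn => /eqP ->; rewrite expr0n eq_sym.
  by case: (n) B_gt1 => //= *; rewrite oner_eq0.
rewrite -[x]/(val (FinRing.unit 'F_p ux)); apply: Kmem.
(* [K] already supplies [n] roots of [X^n - 1]; a root outside [K] would be one too many. *)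
pose rs := [seq val u | u <- enum K]; apply: contraT => xK.
suff : size (x :: rs) <= n by rewrite /= size_map -cardE cardK ltnn.
apply: max_unity_roots; first exact: ltn_trans B_gt1.
  rewrite /= unity_rootE xn eqxx; apply/allP=> _ /mapP[u uK ->].
  by rewrite unity_rootE expK ?eqxx // -mem_enum.
rewrite /= map_inj_uniq ?enum_uniq ?andbT; last exact: val_inj.
apply: contra xK => /mapP[u]; rewrite mem_enum => uK E.
by have -> : FinRing.unit 'F_p ux = u by apply: val_inj.
Qed.

(** * Affine coordinates on [Gpq] *)

Lemma scale_permXE (p n : nat) (a : {unit 'F_p}) x :
  (scale_perm a ^+ n) x = (x * val a ^+ n)%R.
Proof.
elim: n x => [|n IHn] x; first by rewrite perm1 mulr1.
by rewrite expgSr permM IHn permE exprSr mulrA.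
Qed.

Lemma trans1XE (p n : nat) x : (trans1 p ^+ n) x = (x + n%:R)%R.
Proof.
elim: n x => [|n IHn] x; first by rewrite perm1 addr0.
by rewrite expgSr permM IHn permE -addrA natr1.
Qed.

Section AffineGroup.

Variables (p q : nat) (m : {unit 'F_p}).
Hypotheses (p_pr : prime p) (q_pr : prime q) (q_dvd : q %| p.-1)
  (m_prim : (p.-1).-primitive_root%R (val m)).

Local Notation G := (Gpq p q m).
Local Notation gT := (subg_of G).
Local Notation zeta := (val m ^+ (p.-1 %/ q))%R.

(* An element of [Gpq] is [s |-> s * slope x + shift x]. *)
Definition slope (x : gT) : 'F_p := (sgval x 1 - sgval x 0)%R.
Definition shift (x : gT) : 'F_p := sgval x 0%R.

Lemma zeta_prim : q.-primitive_root%R zeta.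
Proof. exact: dvdn_prim_root. Qed.

Lemma q_gt1 : 1 < q. Proof. exact: prime_gt1. Qed.

Lemma q_lt_p : q < p.
Proof.
have p1 := prime_gt1 p_pr; rewrite -(prednK (prime_gt0 p_pr)) ltnS.
by rewrite dvdn_leq // -subn1 subn_gt0.
Qed.

(** The affine maps whose slope is a [q]-th root of unity form a group that contains both
    generators. *)
Lemma Gpq_affine g : g \in G ->
  ((g 1 - g 0) ^+ q = 1 /\ forall s, g s = s * (g 1 - g 0) + g 0)%R.
Proof.
pose A := [set g : {perm 'F_p} | ((g 1 - g 0) ^+ q == 1)%R
  && [forall s, g s == s * (g 1 - g 0) + g 0]%R].
have AP (h : {perm 'F_p}) a b :
    (a ^+ q = 1 -> (forall s, h s = s * a + b) -> h \in A)%R.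
  move=> aq hE; rewrite inE !hE mul1r mul0r add0r addrK aq eqxx.
  by apply/forallP=> s; rewrite hE.
have gA : group_set A.
  apply/group_setP; split=> [|h k].
    by apply: (AP _ 1%R 0%R); rewrite ?expr1n // => s; rewrite perm1 mulr1 addr0.
  rewrite !inE => /andP[/eqP hq /forallP hE] /andP[/eqP kq /forallP kE].
  suff: h * k \in A by rewrite inE.
  apply: (AP _ ((h 1 - h 0) * (k 1 - k 0)) (h 0 * (k 1 - k 0) + k 0))%R.
    by rewrite exprMn hq kq mulr1.
  by move=> s; rewrite permM (eqP (kE (h s))) (eqP (hE s)); ring.
suff sGA : G \subset A.
  move/(subsetP sGA); rewrite inE => /andP[/eqP-> /forallP gE].
  by split=> // s; apply/eqP.
rewrite (_ : A = Group gA) // gen_subG; apply/subsetP=> h /set2P[]->.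
  apply: (AP _ zeta 0%R) => [|s]; first exact: prim_expr_order zeta_prim.
  by rewrite scale_permXE addr0.
apply: (AP _ 1%R 1%R) => [|s]; first by rewrite expr1n.
by rewrite permE mulr1.
Qed.

Lemma sgvalE (x : gT) s : sgval x s = (s * slope x + shift x)%R.
Proof. by have [_] := Gpq_affine (subgP x). Qed.

Lemma slopeXq x : (slope x ^+ q = 1)%R.
Proof. by have [] := Gpq_affine (subgP x). Qed.

Lemma slope_neq0 x : slope x != 0%R.
Proof.
apply: contra_eqN (slopeXq x) => /eqP->.
by rewrite expr0n eqn0Ngt (ltnW q_gt1) eq_sym oner_eq0.
Qed.

Lemma shiftM x y : shift (x * y) = (shift x * slope y + shift y)%R.
Proof. by rewrite {1}/shift morphM ?inE // permM sgvalE. Qed.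

Lemma slopeM x y : slope (x * y) = (slope x * slope y)%R.
Proof.
rewrite {1}/slope !morphM ?inE // !permM !(sgvalE y) !(sgvalE x); ring.
Qed.

Lemma shift1 : shift 1 = 0%R.
Proof. by rewrite /shift morph1 perm1. Qed.

Lemma slope1 : slope 1 = 1%R.
Proof. by rewrite /slope morph1 !perm1 subr0. Qed.

Lemma slopeV x : slope x^-1 = (slope x)^-1%R.
Proof.
apply: (mulfI (slope_neq0 x)).
by rewrite -slopeM mulgV slope1 divff ?slope_neq0.
Qed.

Lemma shiftV x : shift x^-1 = (- (shift x / slope x))%R.
Proof.
apply: (mulIf (slope_neq0 x)); rewrite mulNr divfK ?slope_neq0 //.
by apply/eqP; rewrite -addr_eq0 -shiftM mulVg shift1.
Qed.

Lemma slopeX x n : slope (x ^+ n) = (slope x ^+ n)%R.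
Proof.
elim: n => [|n IHn]; first by rewrite slope1.
by rewrite expgSr slopeM IHn exprSr.
Qed.

Lemma affine_inj x y : slope x = slope y -> shift x = shift y -> x = y.
Proof.
move=> Esl Esh; apply: val_inj; apply/permP=> s.
by rewrite -!/(sgval _) !sgvalE Esl Esh.
Qed.

Definition affine_pt (i : nat) (b : 'F_p) : gT :=
  subg G (zelt q m ^+ i * trans1 p ^+ val b).

Lemma affine_ptP i b :
  slope (affine_pt i b) = (zeta ^+ i)%R /\ shift (affine_pt i b) = b.
Proof.
have E s : sgval (affine_pt i b) s = (s * zeta ^+ i + b)%R.
  rewrite subgK; last first.
    by rewrite groupM // groupX // mem_gen // !inE eqxx ?orbT.
  by rewrite permM trans1XE natr_Zp -expgM scale_permXE exprM.
by rewrite /slope /shift !E mul1r mul0r add0r addrK.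
Qed.

Lemma slope_affine_pt i b : slope (affine_pt i b) = (zeta ^+ i)%R.
Proof. by case: (affine_ptP i b). Qed.

Lemma shift_affine_pt i b : shift (affine_pt i b) = b.
Proof. by case: (affine_ptP i b). Qed.

Lemma exists_affine a b : (a ^+ q = 1)%R -> {x | slope x = a & shift x = b}.
Proof.
move=> /(prim_rootP zeta_prim)[i ->].
by exists (affine_pt i b); rewrite ?slope_affine_pt ?shift_affine_pt.
Qed.

(** The order of the slope divides both [n] and [q]. *)
Lemma slope_eq1_pow x n : coprime n q -> x ^+ n = 1 -> slope x = 1%R.
Proof.
move=> n_q xn; have := slopeX x n; rewrite xn slope1 => /esym slx.
have [k l Ekl _] := egcdnP n (ltnW q_gt1).
have E : (slope x ^+ (k * q) = slope x ^+ (l * n + 1))%R.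
  by rewrite Ekl; move: n_q; rewrite coprime_sym => /eqP->.
move: E; rewrite exprD expr1 mulnC exprM slopeXq expr1n.
by rewrite mulnC exprM slx expr1n mul1r.
Qed.

Lemma translationX x n : slope x = 1%R -> shift (x ^+ n) = (n%:R * shift x)%R.
Proof.
move=> slx; elim: n => [|n IHn]; first by rewrite shift1 mul0r.
by rewrite expgSr shiftM IHn slx mulr1 mulrSr mulrDl mul1r.
Qed.

Lemma slope_ker_normal (T : {group gT}) :
  T =i [pred x | slope x == 1%R] -> T <| [set: gT].
Proof.
move=> memT; apply/normalP; split=> [|y _]; first exact: subsetT.
apply/setP=> z; rewrite mem_conjg !memT !inE conjgE !slopeM !slopeV.
by rewrite invrK mulrCA divff ?mulr1 ?slope_neq0.
Qed.

(** The elements of slope 1 form a normal subgroup of order [p], as the shift maps them bijectively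
    to [F_p]; so every Sylow [p]-subgroup contains it. Conversely, the slope of a [p]-element has
    order dividing both a power of [p] and [q]. *)
Lemma Sylow_slope (T : {group gT}) :
  p.-Sylow([set: gT]) T -> T =i [pred x | slope x == 1%R].
Proof.
move=> sylT x; rewrite inE; apply/idP/eqP => [xT|slx].
  have [k Ek] := p_natP (pHall_pgroup sylT).
  apply: (@slope_eq1_pow x (p ^ k)%N); last by rewrite -Ek expg_cardG.
  by rewrite coprimeXl // prime_coprime // gtnNdvd ?q_lt_p // ltnW ?q_gt1.
have gK : group_set [set x | slope x == 1%R].
  apply/group_setP; rewrite inE slope1; split=> // y z.
  by rewrite !inE slopeM => /eqP-> /eqP->; rewrite mulr1.
have nK : Group gK <| [set: gT] by apply: slope_ker_normal => y; rewrite inE.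
have pK : p.-group [set x | slope x == 1%R].
  rewrite /pgroup; have -> : #|[set x | slope x == 1%R]| = p.
    have sh_inj : {in [set x | slope x == 1%R] &, injective shift}.
      move=> y z; rewrite !inE => /eqP sy /eqP sz.
      by apply: affine_inj; rewrite sy.
    rewrite -(card_in_imset sh_inj) -[RHS](card_Fp p_pr) -cardsT.
    apply: eq_card => b; rewrite inE; apply/imsetP.
    have [y sy <-] := @exists_affine 1%R b (expr1n _ _).
    by exists y; rewrite ?inE ?sy.
  by rewrite pnat_id.
have := @normal_sub_max_pgroup _ _ (Group gK) _ _ (Hall_max sylT) pK nK.
by move/subsetP; apply; rewrite inE slx.
Qed.

Lemma affine_in_Gpq (g : {perm 'F_p}) (a b : 'F_p) :
  (a ^+ q = 1 -> (forall s, g s = s * a + b) -> g \in G)%R.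
Proof.
move=> aq gE; have [x slx shx] := exists_affine b aq.
suff -> : g = sgval x by apply: subgP.
by apply/permP=> s; rewrite gE sgvalE slx shx.
Qed.

(** * Cayley graphs given by one slope and a set of shifts *)

(** The quotient [y * x^-1] has slope [slope y / slope x] and shift [(shift y - shift x) / slope x];
    an arc requires the former to be [a] and the latter to lie in [B]. *)
Definition slope_arc (a : 'F_p) (B : pred 'F_p) : rel gT := fun x y =>
  (slope y == a * slope x)%R && B ((shift y - shift x) / slope x)%R.

Definition slope_graph (a : 'F_p) (B : pred 'F_p) : rel gT := fun x y =>
  slope_arc a B x y || slope_arc a B y x.

Lemma Cay_slope_graph (S : {set gT}) (a : 'F_p) (B : pred 'F_p) :
    (forall s, (s \in S) = (slope s == a) && B (shift s)
                           || (slope s^-1 == a) && B (shift s^-1)) ->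
  Cay S =2 slope_graph a B.
Proof.
move=> SE; have arcE x y :
    (slope (y * x^-1) == a) && B (shift (y * x^-1)) = slope_arc a B x y.
  rewrite /slope_arc slopeM slopeV shiftM shiftV slopeV -mulrBl.
  by rewrite -(inj_eq (mulIf (slope_neq0 x))) divfK ?slope_neq0.
by move=> x y; rewrite /Cay SE invMg invgK !arcE.
Qed.

(** The isomorphism is conjugation by [s |-> s * k + d / (1 - a)]: it keeps slopes and acts on the
    shifts of the elements of slope [a] by [b |-> k * b + d]. *)
Lemma slope_graph_affine_iso (a k d : 'F_p) (B B' : pred 'F_p) :
    a != 1%R -> k != 0%R -> (forall b, B' (k * b + d) = B b)%R ->
  graph_iso (slope_graph a B) (slope_graph a B').
Proof.
move=> a1 k0 BE; have a1' : (a - 1 != 0)%R by rewrite subr_eq0.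
pose sh x := (k * shift x + d * (slope x - 1) / (a - 1))%R.
pose phi x := s2val (exists_affine (sh x) (slopeXq x)).
have slphi x : slope (phi x) = slope x by rewrite /phi; case: exists_affine.
have shphi x : shift (phi x) = sh x by rewrite /phi; case: exists_affine.
exists phi.
  apply: injF_bij => x y E.
  have Esl : slope x = slope y by rewrite -slphi E slphi.
  apply: affine_inj => //; have := shphi x; rewrite E shphi /sh Esl.
  by move/addIr/(mulfI k0).
have arcE x y : slope_arc a B' (phi x) (phi y) = slope_arc a B x y.
  rewrite /slope_arc !slphi !shphi; case: eqP => //= Ey.
  rewrite -BE; congr (B' _); rewrite /sh Ey.
  by field; rewrite slope_neq0 subr_eq0.
by move=> x y; rewrite /slope_graph !arcE.
Qed.

(** * The cycle of slopes, the product graphs and the quotient *)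

Section Logarithm.

Variables (a : 'F_p) (a_prim : q.-primitive_root%R a).

(** With base [a] instead of [zeta], multiplying the slope by [a] becomes one step along the
    cycle. *)
Definition slope_log (x : gT) : 'I_q := sval (prim_rootP a_prim (slopeXq x)).

Lemma slope_logK x : (a ^+ slope_log x = slope x)%R.
Proof. by rewrite /slope_log; case: prim_rootP. Qed.

Lemma slope_log_eq x y : (slope_log x == slope_log y) = (slope x == slope y).
Proof.
by rewrite -!slope_logK (eq_prim_root_expr a_prim) !modn_small.
Qed.

Lemma slope_log_affine (i : 'I_q) x : slope x = (a ^+ i)%R -> slope_log x = i.
Proof.
move=> slx; apply/val_inj/eqP; have := eq_prim_root_expr a_prim (slope_log x) i.
by rewrite slope_logK slx eqxx !modn_small.
Qed.

Lemma cycle_slope_log x y :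
  cycle_graph q (slope_log x) (slope_log y)
  = (slope y == a * slope x)%R || (slope x == a * slope y)%R.
Proof.
rewrite /cycle_graph -!(eq_prim_root_expr a_prim) !exprS !slope_logK.
by rewrite ![(a * _ == _)%R]eq_sym.
Qed.

Definition log_shift (x : gT) : 'I_q * 'I_p :=
  (slope_log x, cast_ord (Fp_cast p_pr) (shift x)).

Lemma log_shift_bij : bijective log_shift.
Proof.
have ls_inj : injective log_shift.
  move=> x y [/eqP]; rewrite slope_log_eq => /eqP Esl /ord_inj Esh.
  exact: affine_inj.
have aXq (i : nat) : ((a ^+ i) ^+ q = 1)%R.
  by rewrite exprAC (prim_expr_order a_prim) expr1n.
pose psi (u : 'I_q * 'I_p) :=
  s2val (exists_affine (cast_ord (esym (Fp_cast p_pr)) u.2) (aXq u.1)).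
have psiK : cancel psi log_shift.
  case=> i b; rewrite /psi /=; case: exists_affine => x slx shx /=.
  by rewrite /log_shift (slope_log_affine slx) shx cast_ordKV.
by exists psi => //; apply: inj_can_sym.
Qed.

Lemma slope_graph_lex_iso (B : pred 'F_p) : (forall b, B b) ->
  graph_iso (slope_graph a B) (lex_prod (cycle_graph q) (empty_graph p)).
Proof.
move=> BT; exists log_shift; first exact: log_shift_bij.
move=> x y; rewrite /lex_prod /= cycle_slope_log andbF orbF.
by rewrite /slope_graph /slope_arc !BT !andbT.
Qed.

Lemma slope_graph_direct_iso (B : pred 'F_p) : (forall b, B b = (b != 0)%R) ->
  graph_iso (slope_graph a B) (direct_prod (complete_graph p) (cycle_graph q)).
Proof.
move=> BE; exists (fun x => ((log_shift x).2, (log_shift x).1)).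
  have sw : bijective (fun u : 'I_q * 'I_p => (u.2, u.1)).
    by exists (fun u => (u.2, u.1)) => -[].
  exact: (bij_comp sw log_shift_bij).
move=> x y; rewrite /direct_prod /complete_graph /= cycle_slope_log.
rewrite (inj_eq (@cast_ord_inj _ _ _)) /slope_graph /slope_arc !BE !mulf_eq0.
rewrite !invr_eq0 !(negPf (slope_neq0 _)) !orbF !subr_eq0 [shift y == _]eq_sym.
by rewrite andb_orr ![(shift x != _) && _]andbC.
Qed.

(** A coset of [T] consists of all elements of a given slope, so the logarithm of that slope
    identifies it; a point of [B] realizes every step of the cycle by an arc. *)
Lemma normal_quotient_slope_graph (e : rel gT) (T : {group gT}) (B : pred 'F_p) b0 :
    T =i [pred x | slope x == 1%R] -> e =2 slope_graph a B -> B b0 ->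
  graph_iso (normal_quotient e T) (cycle_graph q).
Proof.
move=> memT eE Bb0; have nsT := slope_ker_normal memT.
have nT x : x \in 'N(T) by apply: (subsetP (normal_norm nsT)); rewrite inE.
have memC (C : coset_of T) x : (x \in val C) = (slope x == slope (repr C)).
  have := mem_repr_coset C; have [y _ ->] := cosetP C.
  rewrite /= val_coset // !mem_rcoset !memT !inE !slopeM slopeV => /eqP.
  move=> E; rewrite -(inj_eq (mulIf (slope_neq0 y))) divfK ?slope_neq0 // mul1r.
  have := congr1 ( *%R^~ (slope y)) E.
  by rewrite /= divfK ?slope_neq0 // mul1r => ->.
have slope_coset x : slope (repr (coset T x)) = slope x.
  by apply/esym/eqP; rewrite -memC /= val_coset // rcoset_refl.
have aXq (i : nat) : ((a ^+ i) ^+ q = 1)%R.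
  by rewrite exprAC (prim_expr_order a_prim) expr1n.
have a1 : a != 1%R.
  apply: contraTneq q_gt1 => Ea; rewrite -leqNgt.
  by rewrite dvdn_leq // (prim_order_dvd a_prim) Ea expr1n.
exists (fun C : coset_of T => slope_log (repr C)).
  exists (fun i : 'I_q => coset T (s2val (exists_affine 0%R (aXq i)))) => [C|i].
    have [x _ ->] := cosetP C.
    have := slope_logK (repr (coset T x)); rewrite slope_coset.
    move: (slope_log _) => i Ei; apply: val_inj; rewrite /= !val_coset //.
    case: exists_affine => y /= sly _; apply/rcoset_eqP.
    by rewrite mem_rcoset memT inE slopeM slopeV sly Ei divff ?slope_neq0.
  apply: slope_log_affine; rewrite slope_coset.
  by case: exists_affine.
have arc_ex (C D : coset_of T) : (slope (repr D) = a * slope (repr C))%R ->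
    exists x y, [/\ x \in val C, y \in val D & slope_arc a B x y].
  move=> E; have [y sly shy] := exists_affine
    (shift (repr C) + b0 * slope (repr C))%R (slopeXq (repr D)).
  exists (repr C), y; split; rewrite ?memC ?sly //.
  by rewrite /slope_arc sly shy E eqxx addrAC subrr add0r mulfK ?slope_neq0.
move=> C D; rewrite cycle_slope_log /normal_quotient; apply/idP/andP.
  move=> CD; split.
    apply: contraTneq CD => ->; rewrite orbb -[X in X == _]mul1r.
    by rewrite (inj_eq (mulIf (slope_neq0 _))) eq_sym.
  case/orP: CD => /eqP/arc_ex[x [y [xC yD arc]]].
    apply/existsP; exists x; apply/existsP; exists y.
    by rewrite xC yD eE /slope_graph arc.
  apply/existsP; exists y; apply/existsP; exists x.
  by rewrite xC yD eE /slope_graph arc orbT.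
case=> _ /existsP[x /existsP[y]]; rewrite !memC eE => /and3P[/eqP<- /eqP<-].
by case/orP=> /andP[-> _]; rewrite ?orbT.
Qed.

End Logarithm.

(** * Conjugation by affine maps and the graphs [Gamma_pq] *)

Lemma sgval_conj_affine (h : {perm 'F_p}) (u w : 'F_p) (x : gT) s :
    u != 0%R -> (forall r, h r = r * u + w)%R ->
  (sgval x ^ h) s = (s * slope x + (shift x * u + w * (1 - slope x)))%R.
Proof.
move=> u0 hE; pose r := ((s - w) / u)%R.
have -> : s = (r * u + w)%R by rewrite divfK ?subrK.
by rewrite -[in LHS]hE conjgE !permM permK hE sgvalE; ring.
Qed.

Section ConjugationOrbit.

Variable l : nat.
Hypotheses (l_gt1 : 1 < l) (l_dvd : l %| p.-1).

Local Notation mu := (val m ^+ (p.-1 %/ l))%R.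

Lemma mu_prim : l.-primitive_root%R mu.
Proof. exact: dvdn_prim_root. Qed.

Lemma mu_neq1 : mu != 1%R.
Proof.
apply: contraTneq l_gt1 => E; rewrite -leqNgt.
by rewrite dvdn_leq // (prim_order_dvd mu_prim) E expr1n.
Qed.

(** The shift is the geometric sum [1 + mu + ... + mu ^+ (n - 1)]. *)
Lemma H1_genXE n s :
  ((scale_perm m ^+ (p.-1 %/ l) * trans1 p) ^+ n) s
  = (s * mu ^+ n + (mu ^+ n - 1) / (mu - 1))%R.
Proof.
have mu1 : (mu - 1 != 0)%R by rewrite subr_eq0 mu_neq1.
elim: n => [|n IHn]; first by rewrite perm1 mulr1 subrr mul0r addr0.
rewrite expgSr permM IHn permM scale_permXE permE /= exprS.
by move: mu mu1 => u u1; field.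
Qed.

(* [mu ^+ n] is recovered from the shift [(mu ^+ n - 1) / (mu - 1) * (1 - a)] *)
(* of the conjugate of the element [(a, 0)] by the [n]-th power of the        *)
(* generator of [H1].                                                         *)
Definition orbit_shift (a b : 'F_p) : bool :=
  ((1 + b * (mu - 1) / (1 - a)) ^+ l == 1)%R.

Lemma orbit_conj_auts (g x : gT) : slope g != 1%R -> shift g = 0%R ->
  (x \in orbit 'P (conj_auts G (H1 m l)) g)
  = (slope x == slope g) && orbit_shift (slope g) (shift x).
Proof.
move=> slg shg; have mu1 : (mu - 1 != 0)%R by rewrite subr_eq0 mu_neq1.
have slg1 : (1 - slope g != 0)%R by rewrite subr_eq0 eq_sym.
set h := scale_perm m ^+ (p.-1 %/ l) * trans1 p.
have mu0 n : (mu ^+ n != 0)%R.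
  apply: contraNneq mu1; move: (prim_expr_order mu_prim) => mul mun0.
  have : (1 == 0 :> 'F_p)%R.
    rewrite -(expr1n _ n) -mul -exprM mulnC exprM mun0 expr0n.
    by rewrite eqn0Ngt (ltnW l_gt1).
  by rewrite oner_eq0.
have conjE y n s : (sgval y ^ (h ^+ n)) s = (s * slope y
    + (shift y * mu ^+ n + (mu ^+ n - 1) / (mu - 1) * (1 - slope y)))%R.
  exact/sgval_conj_affine/H1_genXE.
apply/orbitP/idP.
  case=> f; rewrite inE.
  case/existsP=> k /andP[/cycleP[n ->] /forallP/(_ g)/eqP Ef] /= <-.
  have -> : slope (f g) = slope g.
    by rewrite {1}/slope Ef -/h !conjE mul1r mul0r add0r addrK.
  rewrite /aperm eqxx {1}/shift Ef -/h conjE shg !mul0r !add0r /orbit_shift /=.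
  have -> : (1 + (mu ^+ n - 1) / (mu - 1) * (1 - slope g) * (mu - 1)
               / (1 - slope g) = mu ^+ n)%R.
    by move: (mu ^+ n)%R mu mu1 => v u u1; field; rewrite slg1 u1.
  by rewrite (exprAC mu) (prim_expr_order mu_prim) expr1n.
(* The root of unity in [orbit_shift] is a power [mu ^+ n]; conjugation by [h ^+ n] is then the
   required automorphism. *)
case/andP=> /eqP slx /eqP/(prim_rootP mu_prim)[n En].
(* Conjugation by an affine map keeps the slope, so the conjugate stays in [G] whether or not [h]
   lies there. *)
have hG (y : gT) : sgval y ^ (h ^+ n) \in G.
  exact: affine_in_Gpq (slopeXq y) (conjE y n).
have f_inj : injective (fun y : gT => subg G (sgval y ^ (h ^+ n))).
  by move=> y z /(congr1 sgval); rewrite !subgK // => /conjg_inj/val_inj.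
exists (perm f_inj).
  rewrite inE; apply/existsP; exists (h ^+ n); rewrite mem_cycle.
  by apply/forallP=> y; rewrite permE subgK.
apply: affine_inj; rewrite /= /aperm permE.
  by rewrite {1}/slope subgK // !conjE mul1r mul0r add0r addrK -slx.
rewrite {1}/shift subgK // conjE shg -En mul0r !add0r.
by move: mu mu1 slg1 => u u1 v1; field; rewrite u1.
Qed.

Lemma orbit_conj_autsV (g x : gT) :
  (x \in orbit 'P (conj_auts G (H1 m l)) g^-1)
  = (x^-1 \in orbit 'P (conj_auts G (H1 m l)) g).
Proof.
have autV f y : f \in conj_auts G (H1 m l) -> f y^-1 = (f y)^-1.
  rewrite inE => /existsP[h /andP[_ /forallP fE]].
  have {}fE z : sgval (f z) = sgval z ^ h by apply/eqP.
  apply: val_inj; change (sgval (f y^-1) = sgval (f y)^-1).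
  by rewrite fE !morphV ?inE //= fE conjVg.
apply/orbitP/orbitP => -[f fA E]; exists f => //=; rewrite /aperm.
  by rewrite -[RHS]/(x^-1) -E /= /aperm autV // invgK.
by move: E; rewrite /= /aperm autV // => ->; rewrite invgK.
Qed.

Lemma Gamma_pqE (i : nat) : (zeta ^+ i != 1)%R ->
  Gamma_pq p q m l i =2 slope_graph (zeta ^+ i)%R (orbit_shift (zeta ^+ i)%R).
Proof.
move=> zi1; rewrite /Gamma_pq /Gamma.
have -> : subg G (zelt q m ^+ i) = affine_pt i 0%R.
  by rewrite /affine_pt mulg1.
apply: Cay_slope_graph => s; rewrite inE orbit_conj_autsV.
by rewrite !orbit_conj_auts ?shift_affine_pt ?slope_affine_pt.
Qed.

End ConjugationOrbit.

(** * Automorphisms of [Gpq] *)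

(** The image of the translation [t] by 1 has trivial [p]-th power, hence slope 1; its shift is [k],
    nonzero by injectivity. *)
Lemma aut_affine (f : gT -> gT) : {morph f : x y / x * y} -> injective f ->
  exists2 k : 'F_p, k != 0%R &
    forall x y, slope x = slope y ->
      slope (f x) = slope x
      /\ (shift (f x) - shift (f y) = k * (shift x - shift y))%R.
Proof.
move=> fM f_inj.
have f1 : f 1 = 1 by apply: (mulgI (f 1)); rewrite -fM !mulg1.
have fX x n : f (x ^+ n) = f x ^+ n.
  by elim: n => [|n IHn]; rewrite ?f1 // !expgSr fM IHn.
have [t slt sht] := @exists_affine 1%R 1%R (expr1n _ _).
have slft : slope (f t) = 1%R.
  apply: (@slope_eq1_pow _ p).
    by rewrite prime_coprime // gtnNdvd ?q_lt_p // ltnW ?q_gt1.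
  rewrite -fX -f1; congr f; apply: affine_inj.
    by rewrite slopeX slt expr1n slope1.
  by rewrite translationX // sht mulr1 shift1 pchar_Fp_0.
have k0 : shift (f t) != 0%R.
  apply: contra_eq_neq sht => shft; have -> : t = 1.
    by apply: f_inj; rewrite f1; apply: affine_inj; rewrite ?slope1 ?shift1.
  by rewrite shift1 eq_sym oner_eq0.
exists (shift (f t)) => //.
have slf x : slope (f x) = slope x.
  (* This relation recovers [slope x] from the action of [x] on [t]; applying [f] and comparing
     shifts gives [slope (f x) = slope x]. *)
  have E : t * x = x * t ^+ val (slope x).
    apply: affine_inj; first by rewrite !slopeM slopeX slt expr1n mulrC.
    rewrite !shiftM translationX // slopeX slt expr1n sht natr_Zp.
    by rewrite mul1r !mulr1 addrC.
  have := congr1 (fun y => shift (f y)) E.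
  rewrite !fM fX !shiftM translationX // slopeX slft expr1n mulr1 natr_Zp.
  rewrite addrC => /addrI; rewrite mulrC; exact: mulIf.
move=> x y Exy; split=> //.
(* Elements of equal slope differ by a power of [t], and [f] multiplies the shift of such a power by
   [k]. *)
have -> : x = y * t ^+ val (shift x - shift y)%R.
  apply: affine_inj; first by rewrite slopeM slopeX slt expr1n mulr1.
  rewrite shiftM translationX // slopeX slt expr1n sht natr_Zp.
  by rewrite !mulr1 addrC subrK.
rewrite fM fX !shiftM !translationX // !slopeX slt slft !expr1n sht natr_Zp.
rewrite !mulr1; ring.
Qed.

(** * The connection set of a connected normal edge-transitive graph *)

Section ConnectionSet.

Variable S : {set gT}.
Hypotheses (S_inv : forall x, x \in S -> x^-1 \in S)
  (S_conn : graph_connected (Cay S)) (S_net : normal_edge_transitive (Cay S)).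

(** Otherwise every edge would join elements of equal slope, and the identity could not be joined to
    an element of slope [zeta]. *)
Lemma exists_slope_neq1 : exists2 s, s \in S & slope s != 1%R.
Proof.
apply/exists_inP; apply: contraT; rewrite negb_exists_in => /forall_inP S1.
have := @graph_connected_closed _ _ (fun u => slope u == 1%R)
  1 (affine_pt 1 0%R) S_conn.
rewrite slope1 eqxx slope_affine_pt expr1 => z1.
have {z1}/esym/eqP z1 : true = (zeta == 1)%R.
  apply: z1 => u v /S1/negPn/eqP; rewrite slopeM slopeV => E.
  by rewrite -[slope v](divfK (slope_neq0 u)) E mul1r.
have := prim_order_dvd zeta_prim 1; rewrite expr1 z1 eqxx => /dvdn_leq.
by move/(_ isT); rewrite leqNgt q_gt1.
Qed.

(** Inverting [s] replaces the exponent [j] of its slope by [q - j], so for odd [q] one of [s] and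
    [s^-1] has its exponent in the lower half. *)
Lemma exists_slope_half : exists g i,
  [/\ g \in S, slope g = (zeta ^+ i)%R, (zeta ^+ i != 1)%R
    & q = 2%N /\ i = 1%N \/ (1 <= i <= (q.-1)./2)%N].
Proof.
have [s sS sl1] := exists_slope_neq1.
have [[j jq] /= Ej] := prim_rootP zeta_prim (slopeXq s).
have j0 : 0 < j by rewrite lt0n; apply: contra_neq sl1 => j0; rewrite Ej j0.
have [q2|q_odd] := even_prime q_pr.
  have Ej1 : j = 1%N by move: jq; rewrite q2; case: j j0 {Ej} => [|[|]].
  by exists s, j; split=> //; [rewrite -Ej | left].
have [jle|jgt] := leqP j (q.-1)./2.
  by exists s, j; split=> //; [rewrite -Ej | right; rewrite j0].
have slV : slope s^-1 = (zeta ^+ (q - j))%R.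
  apply: (mulfI (slope_neq0 s)); rewrite slopeV divff ?slope_neq0 // Ej -exprD.
  by rewrite subnKC ?(ltnW jq) // (prim_expr_order zeta_prim).
exists s^-1, (q - j); split; rewrite ?S_inv // -?slV.
  by rewrite slopeV invr_eq1.
right; rewrite subn_gt0 jq /= leq_subLR.
have Eq : ((q.-1)./2.*2.+1 = q)%N.
  by rewrite even_halfK ?prednK ?prime_gt0 // -oddS prednK ?prime_gt0 ?q_odd.
by rewrite -[X in (X <= _)%N]Eq -addnn -addSn leq_add2r.
Qed.

Variable g : gT.
Hypotheses (gS : g \in S) (slg : slope g != 1%R).

Local Notation a := (slope g).

Definition shift_set : {set 'F_p} := [set shift s | s in S & slope s == a].

Lemma mem_shift_set s : slope s = a -> (shift s \in shift_set) = (s \in S).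
Proof.
move=> sls; apply/imsetP/idP => [[u]|sS]; last first.
  by exists s; rewrite // inE sS sls eqxx.
rewrite inE => /andP[uS /eqP slu] Esh.
by rewrite (_ : s = u) //; apply: affine_inj; rewrite ?slu.
Qed.

(** For [s] in [S], some slope-preserving automorphism takes [g] to [s] or to [s^-1], so one of
    these has slope [a]. *)
Lemma Cay_shift_set : Cay S =2 slope_graph a (mem shift_set).
Proof.
apply: Cay_slope_graph => s /=; apply/idP/idP.
  move=> sS; have [f [fM f_inj fS Ef]] := Cay_aut_transitive S_net gS sS.
  have [k _ /(_ g g erefl)[slf _]] := aut_affine fM f_inj.
  case: Ef => Ef; rewrite Ef in slf; first by rewrite slf eqxx mem_shift_set ?sS.
  by rewrite (mem_shift_set slf) slf eqxx S_inv ?orbT.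
case/orP=> /andP[/eqP sls]; rewrite mem_shift_set // => sS.
by rewrite -[s]invgK S_inv.
Qed.

(** An automorphism that preserves [S] and takes [s] to [s'] acts on the shifts of the elements of
    slope [a] by an affine map. *)
Lemma shift_set_homogeneous b b' : b \in shift_set -> b' \in shift_set ->
  exists k c : 'F_p, [/\ k != 0, k * b + c = b'
    & forall x, (k * x + c \in shift_set) = (x \in shift_set)]%R.
Proof.
case/imsetP=> s; rewrite inE => /andP[sS /eqP sls] ->.
case/imsetP=> s'; rewrite inE => /andP[s'S /eqP sls'] ->.
have [f [fM f_inj fS Ef]] := Cay_aut_transitive S_net sS s'S.
have [k k0 fE] := aut_affine fM f_inj.
(* If [f s = s'^-1] then [a = -1], so [s'] is an involution. *)
have {}Ef : f s = s'.
  case: Ef => // Ef; rewrite Ef.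
  have [slf _] := fE s s erefl; rewrite Ef in slf.
  have a_1 : a = (-1)%R.
    have : (a ^+ 2 == 1)%R.
      by rewrite expr2 -{1}sls -slf -sls' -slopeM mulVg slope1.
    by rewrite sqrf_eq1 (negPf slg) => /eqP.
  apply: affine_inj; first by rewrite slf sls.
  by rewrite shiftV sls' a_1 invrN1 mulrN1 opprK.
exists k, (shift s' - k * shift s)%R; split=> //; first by rewrite addrC subrK.
move=> x; have [u slu <-] := exists_affine x (slopeXq g).
have [slfu Eu] := fE u s (etrans slu (esym sls)); rewrite Ef mulrBr in Eu.
have -> : (k * shift u + (shift s' - k * shift s) = shift (f u))%R.
  by rewrite addrCA -Eu addrC subrK.
by rewrite !mem_shift_set ?fS ?slfu.
Qed.

Lemma card_shift_set : 1 < #|shift_set|.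
Proof.
have gB : shift g \in shift_set by rewrite mem_shift_set.
rewrite ltnNge; apply/negP => B_le1.
have B1 b : b \in shift_set -> b = shift g.
  by move=> bB; apply: (card_le1_eqP B_le1).
have a1 : (1 - a != 0)%R by rewrite subr_eq0 eq_sym.
(* If [B] is a single point then [S] lies in the stabiliser of [s0]. *)
pose s0 := (shift g / (1 - a))%R.
have Es0 : (s0 * a + shift g = s0)%R by rewrite /s0; field.
have arc u v : slope_arc a (mem shift_set) u v ->
    ((s0 * slope u + shift u == s0) = (s0 * slope v + shift v == s0))%R.
  case/andP=> /eqP-> /B1 E.
  have -> : shift v = (shift u + shift g * slope u)%R.
    by rewrite -E divfK ?slope_neq0 // addrC subrK.
  congr (_ == _); rewrite -{1}Es0; ring.
(* The translation by 1 moves [s0], so it cannot be joined to the identity, which fixes [s0]. *)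
have [t slt sht] := @exists_affine 1%R 1%R (expr1n _ _).
have := @graph_connected_closed _ _
  (fun u => s0 * slope u + shift u == s0)%R 1 t S_conn.
rewrite slope1 shift1 slt sht mulr1 addr0 eqxx => E.
have {E}/esym : true = (s0 + 1 == s0)%R.
  by apply: E => u v; rewrite Cay_shift_set => /orP[/arc|/arc].
by rewrite -subr_eq0 addrC addrA addNr add0r oner_eq0.
Qed.

Lemma slope_prim : q.-primitive_root%R a.
Proof.
have [n n_prim n_dvd] := prim_order_exists (prime_gt0 q_pr) (slopeXq g).
have n1 : n != 1%N.
  apply: contra_neq slg => n1; move: (prim_expr_order n_prim).
  by rewrite n1 expr1.
by rewrite -(prime_nt_dvdP q_pr n1 n_dvd).
Qed.

Lemma slope_graph_roots_iso (c d : 'F_p) l : c != 0%R ->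
    (forall x, (c * x + d \in shift_set) = (x ^+ l == 1))%R ->
  graph_iso (Cay S) (slope_graph a (fun b => b ^+ l == 1)%R).
Proof.
move=> c0 cE.
have [|phi phi_bij phiE] := @slope_graph_affine_iso a c^-1%R (- (d / c))%R
    (mem shift_set) (fun b => b ^+ l == 1)%R slg (invr_neq0 c0).
  move=> b; rewrite -cE.
  by have -> : (c * (c^-1 * b - d / c) + d = b)%R by field.
by exists phi => // x y; rewrite phiE Cay_shift_set.
Qed.

Lemma roots_Gamma_pq_iso l i : 1 < l -> l %| p.-1 -> a = (zeta ^+ i)%R ->
  graph_iso (slope_graph a (fun b => b ^+ l == 1)%R) (Gamma_pq p q m l i).
Proof.
move=> l1 l_dvd Ea; pose mu := (val m ^+ (p.-1 %/ l))%R.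
have mu1 : (mu - 1 != 0)%R by rewrite subr_eq0 mu_neq1.
have a1 : (1 - a != 0)%R by rewrite subr_eq0 eq_sym.
apply: (@graph_iso_eqr _ _ _ (slope_graph a (orbit_shift l a))).
  by move=> x y; rewrite Gamma_pqE // -Ea.
(* The map [b |-> k * b - k] is inverse to the affine expression in [orbit_shift], so it carries the
   [l]-th roots of unity onto the shifts of the orbit. *)
pose k := ((1 - a) / (mu - 1))%R.
apply: (@slope_graph_affine_iso a k (- k)%R) => //.
  by rewrite mulf_neq0 ?invr_eq0.
move=> b; rewrite /orbit_shift /k -/mu; congr (_ ^+ _ == _)%R.
by field; rewrite a1 mu1.
Qed.

Lemma Cay_trichotomy i : a = (zeta ^+ i)%R ->
  [\/ graph_iso (Cay S) (lex_prod (cycle_graph q) (empty_graph p)),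
      graph_iso (Cay S) (direct_prod (complete_graph p) (cycle_graph q))
    | exists l, [/\ (1 < l)%N, (l %| p.-1)%N, (l < p.-1)%N
        & graph_iso (Cay S) (Gamma_pq p q m l i)]].
Proof.
move=> Ea.
have [BT|[c [d [l [c0 l1 l_dvd cE]]]]] :=
    affine_homogeneous_set p_pr shift_set_homogeneous card_shift_set.
  constructor 1; have [phi phi_bij phiE] := slope_graph_lex_iso slope_prim
    (fun b => etrans (congr1 (fun B : {set 'F_p} => b \in B) BT) (in_setT b)).
  by exists phi => // x y; rewrite phiE Cay_shift_set.
have roots_iso := slope_graph_roots_iso c0 cE.
have p1 : 0 < p.-1 by rewrite -subn1 subn_gt0 prime_gt1.
(* For [l = p - 1] the roots of unity are all the nonzero elements of [F_p], by Fermat; adjacency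
   then requires distinct shifts, as in the direct product. *)
have [El|l_neq] := eqVneq l p.-1.
  constructor 2; apply: graph_iso_trans roots_iso _.
  apply: (slope_graph_direct_iso slope_prim) => b; rewrite El.
  have [->|b0] := eqVneq b 0%R.
    by rewrite expr0n eqn0Ngt p1 eq_sym oner_eq0.
  have bu : (b \is a GRing.unit)%R by rewrite unitfE.
  have := expg_cardG (in_setT (FinRing.unit 'F_p bu)).
  rewrite card_finField_unit card_Fp // => /(congr1 val).
  by rewrite FinRing.val_unitX /= => ->; rewrite eqxx.
constructor 3; exists l; split=> //; first by rewrite ltn_neqAle l_neq dvdn_leq.
exact: graph_iso_trans roots_iso (roots_Gamma_pq_iso l1 l_dvd Ea).
Qed.

End ConnectionSet.

End AffineGroup.

(** * The classification, with [K_2] as the degenerate cycle for [q = 2] *)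

Lemma cycle_graph2 : cycle_graph 2 =2 complete_graph 2.
Proof. by case=> [[|[|]] ?] // [[|[|]] ?]. Qed.

Theorem proposition2p2 (p q : nat) (p_pr : prime p) (q_pr : prime q)
    (q_dvd : (q %| p.-1)%N)
    (m : {unit 'F_p}) (m_prim : ((p.-1).-primitive_root (val m))%R)
    (S : {set subg_of (Gpq p q m)})
    (S_inv : forall x, x \in S -> x^-1 \in S) (S_1 : 1 \notin S)
    (S_conn : graph_connected (Cay S))
    (S_net : normal_edge_transitive (Cay S))
    (T : {group subg_of (Gpq p q m)})
    (T_Syl : p.-Sylow([set: subg_of (Gpq p q m)]) T) :
  [/\ normal_multicover (Cay S) T,
      q = 2%N -> graph_iso (normal_quotient (Cay S) T) (complete_graph 2),
      odd q -> graph_iso (normal_quotient (Cay S) T) (cycle_graph q)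
    & [\/ (odd q /\
             graph_iso (Cay S) (lex_prod (cycle_graph q) (empty_graph p)))
          \/ (q = 2%N /\
             graph_iso (Cay S) (lex_prod (complete_graph 2) (empty_graph p))),
          (odd q /\
             graph_iso (Cay S) (direct_prod (complete_graph p) (cycle_graph q)))
          \/ (q = 2%N /\
             graph_iso (Cay S) (direct_prod (complete_graph p) (complete_graph 2)))
        | exists l i : nat,
            [/\ (1 < l)%N, (l %| p.-1)%N, (l < p.-1)%N,
                (q = 2%N /\ i = 1%N) \/ (1 <= i <= (q.-1)./2)%N
              & graph_iso (Cay S) (Gamma_pq p q m l i)]]].
Proof.
have memT := Sylow_slope p_pr q_pr q_dvd m_prim T_Syl.
have [g [i [gS slg zi1 i_range]]] :=
  exists_slope_half q_pr q_dvd m_prim S_inv S_conn.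
have slg1 : slope g != 1%R by rewrite slg.
have Tq : graph_iso (normal_quotient (Cay S) T) (cycle_graph q).
  have gB : mem (shift_set S g) (shift g) by rewrite /= mem_shift_set.
  have CayE := Cay_shift_set p_pr q_pr q_dvd m_prim S_inv S_net gS.
  have a_prim := slope_prim q_pr q_dvd m_prim slg1.
  exact: (normal_quotient_slope_graph q_pr q_dvd m_prim a_prim memT CayE gB).
split=> //.
- apply: Cay_multicover; first exact: slope_ker_normal memT.
  move=> x xT; rewrite memT inE; apply/eqP.
  apply: slope_eq1_pow xT => //; have [k ->] := p_natP (pHall_pgroup T_Syl).
  by rewrite coprimeXl // prime_coprime // gtnNdvd ?prime_gt0 ?(q_lt_p p_pr).
- move=> q2; apply: graph_iso_eqr cycle_graph2 _.
  (* Since [q] also occurs in the types of [S] and [T], the equation [q = 2] is transported in the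
     target graph only. *)
  exact: (eq_ind q (fun n => graph_iso _ (cycle_graph n)) Tq _ q2).
have q_cases : odd q \/ q = 2%N by case: (even_prime q_pr); auto.
have [lex|dir|[l [l1 l_dvd l_lt gam]]] :=
  Cay_trichotomy p_pr q_pr q_dvd m_prim S_inv S_conn S_net gS slg1 slg.
- constructor 1; case: q_cases => [q_odd|q2]; [by left | right; split=> //].
  apply: (@graph_iso_eqr _ _ _ (lex_prod (cycle_graph 2) (empty_graph p))).
    by move=> x y; rewrite /lex_prod cycle_graph2.
  exact: (eq_ind q (fun n => graph_iso _ (lex_prod (cycle_graph n) _)) lex _ q2).
- constructor 2; case: q_cases => [q_odd|q2]; [by left | right; split=> //].
  apply: (@graph_iso_eqr _ _ _ (direct_prod (complete_graph p) (cycle_graph 2))).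
    by move=> x y; rewrite /direct_prod cycle_graph2.
  exact: (eq_ind q (fun n => graph_iso _ (direct_prod _ (cycle_graph n))) dir _ q2).
by constructor 3; exists l, i; split.
Qed.
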